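(* Let $G=(V,A)$ be a directed graph, $c:A\to\mathbb{R}^+$ a positive weight function, and $b:\mathcal{P}(V)\to\mathbb{Z}$ submodular. (i) Assume that there exists a set $X\subseteq V$ such that $\partial_{\tilde c}(X)>0$. Then $$\sigma^*=\max\left\{\frac{-b(X)\partial_{\tilde c}(Y)+b(Y)\partial_{\tilde c}(X)}{\delta_{\tilde c}(X)\partial_{\tilde c}(Y)-\delta_{\tilde c}(Y)\partial_{\tilde c}(X)} : X,Y\subseteq V,\ \partial_{\tilde c}(X)\ge 0,\ \partial_{\tilde c}(Y)<0,\ \varrho_{\tilde c}(X)+\delta_{\tilde c}(X)>0\right\},$$ or $\sigma^*=0$ if the maximum above is negative. (ii) If $\partial_{\tilde c}(X)=0$ holds for all $X\subseteq V$, then $s(\kappa)$ is a constant function. In this case $$\sigma^*=\max\left\{\frac{-b(X)}{\delta_{\tilde c}(X)} : X\subseteq V,\ \partial_{\tilde c}(X)=0,\ b(X)<0\right\},$$ or $\sigma^*=0$ if $b(X)\ge0$ holds for all $X\subseteq V$.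
   Context: $G=(V,A)$ is a finite directed graph and $\mathcal{P}(V)$ is the power set of $V$. The function $b$ is submodular if $b(X)+b(Y)\ge b(X\cup Y)+b(X\cap Y)$ for all $X,Y\subseteq V$. For a vector $x\in\mathbb{R}^A$ and $X\subseteq V$, $\varrho_x(X)$ and $\delta_x(X)$ denote the sum of $x(e)$ over the edges $e$ entering, resp. leaving, $X$, and $\partial_x(X):=\varrho_x(X)-\delta_x(X)$. Put $\tilde c(e):=1/c(e)$ for $e\in A$; thus $\varrho_{\tilde c},\delta_{\tilde c},\partial_{\tilde c}$ are these functions for $x=\tilde c$. A submodular flow is a vector $x\in\mathbb{R}^A$ with $\varrho_x(X)-\delta_x(X)\le b(X)$ for every $X\subseteq V$; it is $(l,u)$-bounded if $l\le x\le u$. The weighted spread of $x$ is $\sigma_c(x):=\max_{a\in A}c(a)x(a)-\min_{a\in A}c(a)x(a)$, and $\sigma^*$ is the minimum of $\sigma_c(x)$ over all submodular flows $x$. For $\kappa\in\mathbb{R}$, $s(\kappa)$ denotes the minimal value $\sigma\ge 0$ for which there exists a $(\kappa\tilde c,(\kappa+\sigma)\tilde c)$-bounded submodular flow. Standing assumptions: $G$ has no isolated vertex, and a submodular flow exists, i.e. $b(U)\ge0$ for every $U\subseteq V$ that no edge enters or leaves. *)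

(* Defs.v *)
From HB Require Import structures.
From mathcomp Require Import all_boot all_order all_algebra.
From mathcomp Require Import classical_sets reals.

Set Implicit Arguments.
Unset Strict Implicit.
Unset Printing Implicit Defensive.

Import Order.TTheory GRing.Theory Num.Theory.
Local Open Scope classical_set_scope.
Local Open Scope ring_scope.

(* Parallel edges and loops are allowed. *)
Record digraph := Digraph {
  vertex : finType;
  edge : finType;
  src : edge -> vertex;
  tgt : edge -> vertex }.

Definition no_isolated_vertex (G : digraph) : Prop :=
  forall v : vertex G, exists e : edge G, src e = v \/ tgt e = v.

Definition is_max (R : realType) (S : set R) (m : R) : Prop :=
  S m /\ forall y, S y -> y <= m.

Definition is_min (R : realType) (S : set R) (m : R) : Prop :=
  S m /\ forall y, S y -> m <= y.

Definition submodular (V : finType) (b : {set V} -> int) : Prop :=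
  forall X Y : {set V}, b (X :|: Y) + b (X :&: Y) <= b X + b Y.

Section SubmodularFlow.
Variables (R : realType) (G : digraph).
Implicit Types (x l u c : edge G -> R) (X Y : {set vertex G}).
Implicit Types b : {set vertex G} -> int.

Definition enters (e : edge G) X : bool := (src e \notin X) && (tgt e \in X).
Definition leaves (e : edge G) X : bool := (src e \in X) && (tgt e \notin X).

Definition rho x X : R := \sum_(e | enters e X) x e.
Definition delta x X : R := \sum_(e | leaves e X) x e.
Definition net x X : R := rho x X - delta x X.

Definition winv c (e : edge G) : R := (c e)^-1.

Definition submodular_flow b x : Prop :=
  forall X, rho x X - delta x X <= (b X)%:~R.

Definition bounded l u x : Prop := forall e, l e <= x e <= u e.

(* The two ranges are finite, so that for a graph with an edge [sup] and [inf]
   are the maximum and the minimum; see [wspreadP]. *)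
Definition wspread c x : R :=
  sup (range (fun e => c e * x e)) - inf (range (fun e => c e * x e)).

Definition is_sigma_star c b (sigma : R) : Prop :=
  is_min [set wspread c x | x in [set x | submodular_flow b x]] sigma.

(* [is_s c b kappa sigma] says that s(kappa) is defined and equals [sigma];
   in general no feasible value may exist for some kappa. *)
Definition is_s c b (kappa sigma : R) : Prop :=
  is_min [set sg | 0 <= sg /\
    exists2 x, submodular_flow b x &
      bounded (fun e => kappa * winv c e)
              (fun e => (kappa + sg) * winv c e) x] sigma.

Lemma wspreadP c x (e0 : edge G) : exists M m,
  [/\ is_max (range (fun e => c e * x e)) M,
      is_min (range (fun e => c e * x e)) m & wspread c x = M - m].
Proof.
set f := fun e => c e * x e.
case: (@arg_maxP _ _ _ e0 xpredT f isT) => e1 _ He1.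
case: (@arg_minP _ _ _ e0 xpredT f isT) => e2 _ He2.
have ub : ubound (range f) (f e1) by move=> _ [e _ <-]; apply: He1.
have lb : lbound (range f) (f e2) by move=> _ [e _ <-]; apply: He2.
exists (f e1), (f e2); split.
- by split; [exists e1|].
- by split; [exists e2|].
rewrite /wspread; congr (_ - _); apply/eqP; rewrite eq_le; apply/andP; split.
- by apply: ge_sup => //; exists (f e1), e1.
- by apply: ub_le_sup; [exists (f e1)|exists e1].
- by apply: ge_inf; [exists (f e2)|exists e2].
- by apply: lb_le_inf => //; exists (f e2), e2.
Qed.

End SubmodularFlow.

(* Main.v *)
Require Import Defs.
From HB Require Import structures.
From mathcomp Require Import all_boot all_order all_algebra.
From mathcomp Require Import classical_sets reals.
From mathcomp Require Import lra.

(** Bounding [c * x] between [kappa] and [kappa + sigma] turns the weighted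
    spread into a two-parameter problem: [sigma^*] is the least [sigma >= 0]
    such that, for some [kappa], a submodular flow fits between [kappa / c] and
    [(kappa + sigma) / c].

    The heart of the proof is the feasibility theorem for bounded submodular
    flows ([bounded_flow_exists]): for [l <= u], a submodular flow between [l]
    and [u] exists as soon as the cut condition
    [rho l X - delta u X <= b X] holds for every [X].  When [b] is submodular
    on all subsets this has a short proof.  One shrinks the interval of a
    single edge [e] to a point [t] without destroying the cut condition.  Sets
    entered by [e] bound [t] from above and sets left by [e] bound it from
    below, and these bounds are compatible because uncrossing a set [X] entered
    by [e] with a set [Y] left by [e] gains at least [u e - l e]: the edge [e]
    joins [Y \ X] to [X \ Y], hence disappears from the cuts of both the union
    and the intersection ([cutval_uncross]).

    For the bounds [kappa / c] and [(kappa + sigma) / c] the cut condition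
    becomes the family of linear inequalities
    [kappa * net X - sigma * delta X <= b X] in the unknowns [kappa], [sigma].
    Fourier-Motzkin elimination of [kappa] then gives the formulas.  Sets with
    positive net bound [kappa] from above and those with negative net from
    below, so each pair [X], [Y] with [net X >= 0 > net Y], where some edge
    crosses [X], contributes the lower bound on [sigma] that appears in
    part (i); a set [X] of net zero already bounds [sigma] by itself, and its
    fraction with any [Y] reduces to [- b X / delta X].  In part (ii) every
    net vanishes, so [kappa] disappears from the inequalities. *)

Set Implicit Arguments.
Unset Strict Implicit.
Unset Printing Implicit Defensive.

Import Order.TTheory GRing.Theory Num.Theory.
Local Open Scope classical_set_scope.
Local Open Scope ring_scope.

(** * Feasibility of bounded submodular flows *)

Section Feasibility.
Variables (R : realType) (G : digraph).
Implicit Types (x l u : edge G -> R) (X Y : {set vertex G}) (e : edge G).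

Definition cutval l u X : R := rho l X - delta u X.

Definition cutterm l u e X : R :=
  (if enters e X then l e else 0) - (if leaves e X then u e else 0).

Lemma cutvalE l u X : cutval l u X = \sum_e cutterm l u e X.
Proof.
by rewrite /cutval /rho /delta big_mkcond [X in _ - X]big_mkcond -sumrB.
Qed.

Lemma cutterm_supermodular l u e X Y : l e <= u e ->
  cutterm l u e X + cutterm l u e Y
  <= cutterm l u e (X :|: Y) + cutterm l u e (X :&: Y).
Proof.
rewrite /cutterm /enters /leaves !inE.
by do 4![case: (_ \in _) => /=]; lra.
Qed.

(** The two cuts through [e] cancel: [e] runs from [Y \ X] to [X \ Y], so it
    crosses neither the union nor the intersection, whereas it contributes
    [l e - u e] to the left-hand cuts. *)
Lemma cutval_uncross l u e X Y : (forall f, l f <= u f) ->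
  enters e X -> leaves e Y ->
  cutval l u X + cutval l u Y + (u e - l e)
  <= cutval l u (X :|: Y) + cutval l u (X :&: Y).
Proof.
move=> lu eX eY; rewrite !cutvalE !(bigD1 (P := xpredT) e) //=.
set sX := \sum_(_ | _) _; set sY := \sum_(_ | _) _.
set sU := \sum_(_ | _) _; set sI := \sum_(_ | _) _.
have rest : sX + sY <= sU + sI.
  rewrite -!big_split /=; apply: ler_sum => f _.
  exact: cutterm_supermodular.
have eE : cutterm l u e X + cutterm l u e Y + (u e - l e)
    = cutterm l u e (X :|: Y) + cutterm l u e (X :&: Y).
  move: eX eY; rewrite /cutterm /enters /leaves !inE.
  by do 4![case: (_ \in _) => //=]; lra.
by lra.
Qed.

Definition reset x e (t : R) : edge G -> R :=
  fun f => if f == e then t else x f.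

Lemma cutval_reset l u e t X :
  cutval (reset l e t) (reset u e t) X
  = cutval l u X + (if enters e X then t - l e else 0)
    - (if leaves e X then t - u e else 0).
Proof.
rewrite !cutvalE !(bigD1 (P := xpredT) e) //=.
rewrite (eq_bigr (fun f => cutterm l u f X)); last first.
  by move=> f /negbTE fe; rewrite /cutterm /reset fe.
rewrite /cutterm /reset eqxx.
by case: (enters e X); case: (leaves e X); lra.
Qed.

(** The admissible values of [t] form an interval whose lower and upper ends
    are finite maxima and minima; the uncrossing inequality is what makes this
    interval nonempty. *)
Lemma tighten_edge (b : {set vertex G} -> R) l u e :
  (forall X Y, b (X :|: Y) + b (X :&: Y) <= b X + b Y) ->
  (forall f, l f <= u f) -> (forall X, cutval l u X <= b X) ->
  exists2 t, l e <= t <= u e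
    & forall X, cutval (reset l e t) (reset u e t) X <= b X.
Proof.
move=> bsub lu cutb.
pose t := \big[Num.max/l e]_(Y | leaves e Y) (u e + cutval l u Y - b Y).
have t_ge Y : leaves e Y -> u e + cutval l u Y - b Y <= t.
  by move=> eY; apply: (le_bigmax_cond _ (fun Y => u e + cutval l u Y - b Y)).
have lt : l e <= t by exact: bigmax_ge_id.
have tu : t <= u e.
  by apply: bigmax_le => // Y _; have := cutb Y; lra.
have t_le X : enters e X -> t <= b X - cutval l u X + l e.
  move=> eX; apply: bigmax_le; first by have := cutb X; lra.
  move=> Y eY; have := cutval_uncross lu eX eY; have := bsub X Y.
  by have := cutb (X :|: Y); have := cutb (X :&: Y); lra.
exists t; first by rewrite lt tu.
move=> X; rewrite cutval_reset; have := cutb X.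
case: (boolP (enters e X)) => [eX|_].
  have /negbTE-> : ~~ leaves e X.
    by move: eX; rewrite /enters /leaves; case: (src e \in X).
  by have := t_le X eX; lra.
case: (boolP (leaves e X)) => [eX|_]; last by lra.
by have := t_ge X eX; lra.
Qed.

Theorem bounded_flow_exists (b : {set vertex G} -> int) l u :
  submodular b -> (forall e, l e <= u e) ->
  (forall X, cutval l u X <= (b X)%:~R) ->
  exists2 x, submodular_flow b x & bounded l u x.
Proof.
move=> bsub lu cutb.
(* Once every edge has been tightened, the two bounds coincide and the cut
   condition for them says that they form a submodular flow. *)
have [l' [u' [lu' cutb' eq_lu sub_lu]]] : exists l' u',
    [/\ forall e, l' e <= u' e, forall X, cutval l' u' X <= (b X)%:~R,
        {in enum (edge G), l' =1 u'} & forall e, l e <= l' e /\ u' e <= u e].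
  elim: (enum _) => [|e s [l' [u' [lu' cutb' eq_lu sub_lu]]]].
    by exists l, u; split.
  have bsubR X Y : (b (X :|: Y))%:~R + (b (X :&: Y))%:~R
      <= (b X)%:~R + (b Y)%:~R :> R.
    by rewrite -!intrD ler_int.
  have [t /andP[lt tu] cutt] := tighten_edge e bsubR lu' cutb'.
  exists (reset l' e t), (reset u' e t); split=> //.
  - by move=> f; rewrite /reset; case: ifP.
  - move=> f; rewrite inE /reset; case: ifP => //= _ fs; exact: eq_lu.
  - move=> f; have [lf uf] := sub_lu f; rewrite /reset; case: eqP => // ->.
    by have [? ?] := sub_lu e; split; [apply: le_trans lt|apply: le_trans tu _].
have l'E e : l' e = u' e by apply: eq_lu; rewrite mem_enum.
exists l' => [X|e]; last first.
  by have [-> ?] := sub_lu e; apply: le_trans (lu' e) _.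
have dE : delta u' X = delta l' X by apply: eq_bigr => e _; rewrite l'E.
by have := cutb' X; rewrite /cutval dE.
Qed.

Lemma cutval_bounded l u x X :
  bounded l u x -> cutval l u X <= rho x X - delta x X.
Proof.
move=> bx; apply: lerB; apply: ler_sum => e _; by case/andP: (bx e).
Qed.

Lemma net_setC x X : net x (~: X) = - net x X.
Proof.
rewrite /net /rho /delta opprB; congr (_ - _); apply: eq_bigl => e;
  by rewrite /enters /leaves !inE negbK andbC.
Qed.

End Feasibility.

(** * Reduction to linear inequalities in kappa and sigma *)

Section Reduction.
Variables (R : realType) (G : digraph) (c : edge G -> R).
Variable b : {set vertex G} -> int.
Hypothesis hc : forall e, 0 < c e.
Implicit Types (x : edge G -> R) (X Y : {set vertex G}).

Local Notation rc := (rho (winv c)).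
Local Notation dc := (delta (winv c)).
Local Notation nc := (net (winv c)).

Definition fits (kappa sigma : R) : Prop :=
  forall X, kappa * nc X - sigma * dc X <= (b X)%:~R.

Lemma winv_gt0 e : 0 < winv c e.
Proof. by rewrite invr_gt0. Qed.

Lemma rho_winv_ge0 X : 0 <= rc X.
Proof. by apply: sumr_ge0 => e _; apply/ltW/winv_gt0. Qed.

Lemma delta_winv_ge0 X : 0 <= dc X.
Proof. by apply: sumr_ge0 => e _; apply/ltW/winv_gt0. Qed.

Lemma winv_sum_eq0 (P : pred (edge G)) x :
  \sum_(e | P e) winv c e = 0 -> \sum_(e | P e) x e = 0.
Proof.
move=> s0; apply: big1 => e Pe.
have := psumr_eq0P (fun e _ => ltW (winv_gt0 e)) s0 Pe.
by move=> e0; have := winv_gt0 e; rewrite e0 ltxx.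
Qed.

(** A set that no edge crosses has net 0 under any flow, which [b X] bounds. *)
Lemma uncut_ge0 X : (exists x, submodular_flow b x) ->
  rc X = 0 -> dc X = 0 -> 0 <= (b X)%:~R :> R.
Proof.
move=> [x /(_ X)] + r0 d0; rewrite /rho /delta.
by rewrite (winv_sum_eq0 x r0) (winv_sum_eq0 x d0) subr0.
Qed.

Lemma cutval_strip kappa sigma X :
  cutval (fun e => kappa * winv c e) (fun e => (kappa + sigma) * winv c e) X
  = kappa * nc X - sigma * dc X.
Proof. by rewrite /cutval /net /rho /delta -!mulr_sumr; lra. Qed.

Lemma strip_flowP kappa sigma : submodular b -> 0 <= sigma ->
  (exists2 x, submodular_flow b x &
     bounded (fun e => kappa * winv c e)
             (fun e => (kappa + sigma) * winv c e) x)
  <-> fits kappa sigma.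
Proof.
move=> bsub s0; split=> [[x fx bx] X|fit].
  by rewrite -cutval_strip; apply: le_trans (cutval_bounded X bx) (fx X).
apply: bounded_flow_exists => // [e|X]; last by rewrite cutval_strip.
by rewrite ler_pM2r ?winv_gt0 // lerDl.
Qed.

Lemma winv_boundedE kappa mu x :
  bounded (fun e => kappa * winv c e) (fun e => mu * winv c e) x
  <-> forall e, kappa <= c e * x e <= mu.
Proof.
by split=> bx e; move: (bx e); rewrite /winv ler_pdivrMr // ler_pdivlMr //
  [x e * _]mulrC.
Qed.

(** Both extrema are taken over the empty set, where their value is 0. *)
Lemma wspread_edgeless x : xpredT =1 (xpred0 : pred (edge G)) ->
  wspread c x = 0.
Proof.
move=> noE; have r0 : range (fun e => c e * x e) = set0.
  by rewrite -subset0 => y [e]; have := noE e.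
by rewrite /wspread r0 sup0 inf0 subrr.
Qed.

Lemma wspread_strip x : 0 <= wspread c x /\ exists kappa,
  bounded (fun e => kappa * winv c e)
          (fun e => (kappa + wspread c x) * winv c e) x.
Proof.
case: (pickP (xpredT : pred (edge G))) => [e0 _|noE]; last first.
  by split; [rewrite wspread_edgeless|exists 0 => e; have := noE e].
have [M [m [[_ leM] [[e1 _ <-] lem] ->]]] := wspreadP c x e0.
split; first by rewrite subr_ge0; apply: leM; exists e1.
exists (c e1 * x e1); apply/winv_boundedE => e.
by rewrite lem /=; [rewrite addrC subrK; apply: leM; exists e|exists e].
Qed.

Lemma wspread_le kappa sigma x : 0 <= sigma ->
  bounded (fun e => kappa * winv c e)
          (fun e => (kappa + sigma) * winv c e) x ->
  wspread c x <= sigma.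
Proof.
move=> s0 /winv_boundedE bx.
case: (pickP (xpredT : pred (edge G))) => [e0 _|noE]; last first.
  by rewrite wspread_edgeless.
have [M [m [[[e1 _ <-] _] [[e2 _ <-] _] ->]]] := wspreadP c x e0.
by case/andP: (bx e1) => _ ?; case/andP: (bx e2) => ? _; lra.
Qed.

Lemma sigma_star_fits sigma : submodular b ->
  is_min [set s | 0 <= s /\ exists kappa, fits kappa s] sigma ->
  is_sigma_star c b sigma.
Proof.
move=> bsub [[s0 [kappa fit]] smin].
have lower x : submodular_flow b x -> sigma <= wspread c x.
  move=> fx; have [w0 [k bx]] := wspread_strip x.
  by apply: smin; split=> //; exists k; apply/strip_flowP => //; exists x.
split; last by move=> _ [x fx <-]; apply: lower.
have /(strip_flowP _ bsub s0) [x fx bx] := fit.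
exists x => //; apply/eqP; rewrite eq_le lower // andbT.
exact: wspread_le bx.
Qed.

(** * Elimination of kappa *)

Definition pair_ok (p : {set vertex G} * {set vertex G}) : bool :=
  [&& 0 <= nc p.1, nc p.2 < 0 & 0 < rc p.1 + dc p.1].

Definition pair_ratio (p : {set vertex G} * {set vertex G}) : R :=
  (- (b p.1)%:~R * nc p.2 + (b p.2)%:~R * nc p.1)
  / (dc p.1 * nc p.2 - dc p.2 * nc p.1).

(** The denominator is negative, since [delta Y] is positive as soon as
    [net Y < 0], and either [net X] or [delta X] is positive.  Dividing by it
    reverses the inequality obtained by combining the constraints of [X] and
    [Y] with weights [- net Y] and [net X]. *)
Lemma pair_ratio_le X Y sigma : pair_ok (X, Y) ->
  (pair_ratio (X, Y) <= sigma)
  = ((b X)%:~R * nc Y - (b Y)%:~R * nc X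
     <= sigma * (dc Y * nc X - dc X * nc Y)).
Proof.
case/and3P => /= nX nY XY.
have dX := delta_winv_ge0 X; have rY := rho_winv_ge0 Y.
have dY : 0 < dc Y by move: nY; rewrite /net; lra.
have D0 : dc X * nc Y - dc Y * nc X < 0.
  move: nX; rewrite le_eqVlt => /orP[/eqP nX|nX]; last by nra.
  have dX0 : 0 < dc X by move: nX; rewrite /net; lra.
  by rewrite -nX; nra.
by rewrite /pair_ratio /= ler_ndivrMr //; apply/idP/idP; lra.
Qed.

Lemma fits_pair_ratio kappa sigma p :
  pair_ok p -> fits kappa sigma -> pair_ratio p <= sigma.
Proof.
case: p => X Y ok fit; rewrite pair_ratio_le //.
by case/and3P: ok => /= nX nY _; have := fit X; have := fit Y; nra.
Qed.

(** [kappa] is taken as the largest of its lower bounds, those given by the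
    sets of negative net; [Y0] makes sure that there is one. *)
Lemma pair_ratio_fits sigma Y0 : (exists x, submodular_flow b x) ->
  nc Y0 < 0 -> (forall p, pair_ok p -> pair_ratio p <= sigma) ->
  exists kappa, fits kappa sigma.
Proof.
move=> hflow nY0 ratios.
pose low Y := ((b Y)%:~R + sigma * dc Y) / nc Y.
exists (\big[Num.max/low Y0]_(Y | nc Y < 0) low Y) => X.
set kappa := \big[_/_]_(_ | _) _.
have [nX|nX] := ltP (nc X) 0.
  have : low X <= kappa by apply: le_bigmax_cond.
  by rewrite /low ler_ndivrMr //; lra.
have [XY|XY] := ltP 0 (rc X + dc X); last first.
  have r0 := rho_winv_ge0 X; have d0 := delta_winv_ge0 X.
  have rX : rc X = 0 by lra.
  have dX : dc X = 0 by lra.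
  have := uncut_ge0 hflow rX dX; rewrite /net rX dX; lra.
have combine Y : nc Y < 0 -> (b X)%:~R * nc Y - (b Y)%:~R * nc X
    <= sigma * (dc Y * nc X - dc X * nc Y).
  by move=> nY; rewrite -pair_ratio_le ?ratios // /pair_ok /= nX nY XY.
have [nX0|nX0] := eqVneq (nc X) 0.
  have := combine _ nY0; rewrite nX0 => cY0.
  by rewrite mulr0; nra.
have nXp : 0 < nc X by rewrite lt_neqAle eq_sym nX0.
suff : kappa <= ((b X)%:~R + sigma * dc X) / nc X.
  by rewrite ler_pdivlMr //; lra.
have low_le Y : nc Y < 0 -> low Y <= ((b X)%:~R + sigma * dc X) / nc X.
  move=> nY; rewrite ler_pdivlMr // /low mulrAC ler_ndivrMr //.
  by have := combine Y nY; lra.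
by apply: bigmax_le => [|Y nY]; apply: low_le.
Qed.

Lemma pair_ratio_max Xp : 0 < nc Xp -> exists2 p, pair_ok p
  & forall q, pair_ok q -> pair_ratio q <= pair_ratio p.
Proof.
move=> nXp.
have ok0 : pair_ok (Xp, ~: Xp).
  rewrite /pair_ok /= net_setC oppr_lt0 nXp ltW //=.
  have := rho_winv_ge0 Xp; have := delta_winv_ge0 Xp.
  by move: nXp; rewrite /net; lra.
by case: (arg_maxP pair_ratio ok0) => p okp pmax; exists p.
Qed.

(** When all nets vanish, [kappa] drops out, and a set with [b X < 0] must have
    [delta X > 0], for it would otherwise be cut by no edge at all. *)
Lemma balanced_fits : (exists x, submodular_flow b x) ->
  (forall X, nc X = 0) -> exists s0 : R,
  [/\ 0 <= s0,
      forall kappa s, 0 <= s -> (fits kappa s <-> s0 <= s),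
      (exists X, b X < 0) ->
         is_max [set r | exists X,
                   [/\ nc X = 0, b X < 0 & r = - (b X)%:~R / dc X]] s0
    & (forall X, 0 <= b X) -> s0 = 0].
Proof.
move=> hflow bal.
have dX0 X : b X < 0 -> 0 < dc X.
  move=> bX; rewrite lt_neqAle delta_winv_ge0 andbT eq_sym; apply/eqP => d0.
  have r0 : rc X = 0 by move: (bal X); rewrite /net d0 subr0.
  by have := uncut_ge0 hflow r0 d0; rewrite ler0z leNgt bX.
pose ratio X : R := - (b X)%:~R / dc X.
have fitsE kappa s : 0 <= s ->
    fits kappa s <-> forall X, b X < 0 -> ratio X <= s.
  move=> s0; split=> [fit X bX|rs X].
    rewrite /ratio ler_pdivrMr ?dX0 //.
    by have := fit X; rewrite bal; lra.
  rewrite bal; have [bX|bX] := ltP (b X) 0.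
    by have := rs X bX; rewrite /ratio ler_pdivrMr ?dX0 //; lra.
  have : 0 <= (b X)%:~R :> R by rewrite ler0z.
  by have := mulr_ge0 s0 (delta_winv_ge0 X); lra.
case: (pickP (fun X => b X < 0)) => [X0 bX0|b_ge0].
  case: (arg_maxP (P := fun X => b X < 0) ratio bX0) => X1 bX1 max1.
  exists (ratio X1); split.
  - by rewrite divr_ge0 ?delta_winv_ge0 // oppr_ge0 lerz0 ltW.
  - move=> kappa s s0; rewrite fitsE //; split=> [|le_s X bX]; first exact.
    exact: le_trans (max1 X bX) le_s.
  - by move=> _; split; [exists X1; split|move=> _ [X [_ bX ->]]; apply: max1].
  - by move=> /(_ X0); rewrite leNgt bX0.
exists 0; split=> //.
- by move=> kappa s s0; rewrite fitsE //; split=> // _ X; rewrite b_ge0.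
- by case=> X; rewrite b_ge0.
Qed.

End Reduction.

(** * The minimum weighted spread *)

Theorem theorem4p4 (R : realType) (G : digraph)
    (c : edge G -> R) (b : {set vertex G} -> int)
    (hG : no_isolated_vertex G)
    (hc : forall e : edge G, 0 < c e)
    (hb : submodular b)
    (hflow : exists x : edge G -> R, submodular_flow b x) :
  ((exists X : {set vertex G}, 0 < net (winv c) X) ->
   exists sigma m : R,
     [/\ is_sigma_star c b sigma,
         is_max
           [set r : R | exists X Y : {set vertex G},
              [/\ 0 <= net (winv c) X,
                  net (winv c) Y < 0,
                  0 < rho (winv c) X + delta (winv c) X &
                  r = (- (b X)%:~R * net (winv c) Y
                       + (b Y)%:~R * net (winv c) X)
                      / (delta (winv c) X * net (winv c) Y
                         - delta (winv c) Y * net (winv c) X)]] m &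
         sigma = if m < 0 then 0 else m])
  /\
  ((forall X : {set vertex G}, net (winv c) X = 0) ->
   (exists s0 : R, forall kappa : R, is_s c b kappa s0)
   /\
   exists sigma : R,
     [/\ is_sigma_star c b sigma,
         (exists X : {set vertex G}, b X < 0) ->
         is_max
           [set r : R | exists X : {set vertex G},
              [/\ net (winv c) X = 0,
                  b X < 0 &
                  r = - (b X)%:~R / delta (winv c) X]] sigma &
         (forall X : {set vertex G}, 0 <= b X) -> sigma = 0]).
Proof.
split=> [[Xp nXp]|bal].
  have [p okp pmax] := pair_ratio_max b hc nXp.
  pose m := pair_ratio c b p.
  exists (Num.max 0 m), m; split.
  - apply: sigma_star_fits => //; split=> /=.
      split; first by rewrite le_max lexx.
      apply: (@pair_ratio_fits _ _ _ _ hc _ (~: Xp)) => //.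
        by rewrite net_setC oppr_lt0.
      by move=> q /pmax le_q; rewrite le_max le_q orbT.
    by move=> s [s0 [kappa /(fits_pair_ratio hc okp) ms]]; rewrite ge_max s0.
  - split=> /=; first by case/and3P: okp => *; exists p.1, p.2.
    move=> _ [X [Y [nX nY XY ->]]].
    by apply: (pmax (X, Y)); rewrite /pair_ok /= nX nY.
  - by case: ltP.
have [s0 [s0_ge0 fitsE s0_max s0_eq0]] := balanced_fits hc hflow bal.
split.
  exists s0 => kappa; split=> /=.
    by split=> //; apply/(strip_flowP hc kappa hb s0_ge0)/fitsE.
  by move=> s [s_ge0 /(strip_flowP hc kappa hb s_ge0) /fitsE]; apply.
exists s0; split=> //; apply: sigma_star_fits => //; split=> /=.
  by split=> //; exists 0; apply/fitsE.
by move=> s [s_ge0 [kappa /fitsE]]; apply.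
Qed.
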